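(* Let $\mathcal{T}\colon\mathcal{U}\to\mathcal{U}$ be a $C$-cocoercive operator for some $C>0$, let $L\colon\mathcal{U}\to\mathcal{V}$ be a bounded linear operator, and let $f\colon\mathcal{V}\to\mathbb{R}\cup\{+\infty\}$ and $g\colon\mathcal{U}\to\mathbb{R}\cup\{+\infty\}$ be proper, convex and lower semicontinuous. Let $0<\alpha<2C$, $0<\beta<1/\|L\|^2$, $k_{\max}\in\mathbb{N}$ with $k_{\max}\ge 1$, and $\{\gamma_n\}_{n\ge 0}\subseteq\mathbb{R}_{\ge 0}$. Let $u_0=u_{-1}\in\mathcal{U}$ and $v_{-1}^{k_{\max}}\in\mathcal{V}$ be arbitrary, and generate sequences for $n=0,1,2,\ldots$ by $$\bar u_n=u_n+\gamma_n(u_n-u_{n-1}),\qquad v_n^0=v_{n-1}^{k_{\max}},$$ $$u_n^k=\operatorname{prox}_{\alpha g}\bigl(\bar u_n-\alpha(\mathcal{T}(\bar u_n)+L^*v_n^k)\bigr),\qquad v_n^{k+1}=\operatorname{prox}_{\beta\alpha^{-1}f^*}\bigl(v_n^k+\beta\alpha^{-1}Lu_n^k\bigr)\qquad (k=0,\ldots,k_{\max}-1),$$ $$u_n^{k_{\max}}=\operatorname{prox}_{\alpha g}\bigl(\bar u_n-\alpha(\mathcal{T}(\bar u_n)+L^*v_n^{k_{\max}})\bigr),\qquad u_{n+1}=\frac{1}{k_{\max}}\sum_{k=1}^{k_{\max}}u_n^k.$$ Assume that the sequence $\{\gamma_n\}$ is such that $$\sum_{n=0}^\infty\gamma_n\|u_n-u_{n-1}\|<\infty.$$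 If the problem of finding $\hat u\in\mathcal{U}$ with $0\in\mathcal{T}(\hat u)+\partial(f\circ L)(\hat u)+\partial g(\hat u)$ has a solution in the primal-dual sense, that is, if there exists a pair $(\hat u,\hat v)\in\mathcal{U}\times\mathcal{V}$ with $-L^*\hat v\in\mathcal{T}(\hat u)+\partial g(\hat u)$ and $\hat v\in\partial f(L\hat u)$, then the sequence $\{(u_n,v_n^0)\}$ is bounded and converges to such a primal-dual solution $(\hat u,\hat v)$.
   Context: $\mathcal{U}$ and $\mathcal{V}$ are real Hilbert spaces. An operator $\mathcal{T}\colon\mathcal{U}\to\mathcal{U}$ is $C$-cocoercive ($C>0$) if $\langle\mathcal{T}x-\mathcal{T}y,x-y\rangle\ge C\|\mathcal{T}x-\mathcal{T}y\|^2$ for all $x,y\in\mathcal{U}$. For a proper, convex, lower semicontinuous function $h$ on a Hilbert space $\mathcal{H}$ and $\tau>0$, $\operatorname{prox}_{\tau h}(x)=\operatorname{arg\,min}_{u\in\mathcal{H}}\{\tau h(u)+\frac12\|u-x\|^2\}$. $\partial$ denotes the convex subdifferential, $f^*$ the Fenchel conjugate of $f$, and $L^*$ the adjoint of $L$.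
   Formalization: ''Converges'' is proved as weak convergence of u_n and v_n^0 in general Hilbert spaces, and as norm convergence when U and V are finite-dimensional; norm convergence fails in general (T=0, f=0, L=id, k_max=1, γ=0 gives the proximal point algorithm, Güler 1991). *)

(* Defs.v *)
(* MathComp-Analysis, over an arbitrary R : realType. *)
From HB Require Import structures.
From mathcomp Require Import all_boot all_order all_algebra.
From mathcomp Require Import all_classical all_reals all_analysis.

Set Implicit Arguments.
Unset Strict Implicit.
Unset Printing Implicit Defensive.

Import Order.TTheory GRing.Theory Num.Theory.
Import numFieldNormedType.Exports.

Local Open Scope classical_set_scope.
Local Open Scope ring_scope.

(* Positive definiteness of the inner product follows from [inner_norm]. *)
HB.mixin Record NormedModule_hasInner (R : realType) H
    of CompleteNormedModule R H := {
  inner : H -> H -> R ;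
  innerC : forall x y, inner x y = inner y x ;
  innerDl : forall x y z, inner (x + y) z = inner x z + inner y z ;
  innerZl : forall (a : R) x y, inner (a *: x) y = a * inner x y ;
  inner_norm : forall x, inner x x = `|x| ^+ 2
}.

#[short(type="hilbertType")]
HB.structure Definition Hilbert (R : realType) :=
  {H of NormedModule_hasInner R H & CompleteNormedModule R H}.

Section operators.
Context {R : realType} {U V : hilbertType R}.

Definition cocoercive (C : R) (T : U -> U) : Prop :=
  forall x y, C * `|T x - T y| ^+ 2 <= inner (T x - T y) (x - y).

(* A real supremum: meaningful only when [L] is bounded. *)
Definition opnorm (L : U -> V) : R :=
  sup [set `|L x| | x in [set x : U | `|x| <= 1]].

(* By the Riesz representation theorem the vector [w] exists and is unique for
   every bounded linear [L], so the default value 0 is then never used. *)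
Definition adjoint (L : U -> V) (y : V) : U :=
  xget 0 [set w : U | forall x, inner (L x) y = inner x w].

End operators.

Section convex_analysis.
Context {R : realType} {H : hilbertType R}.
Implicit Types (h : H -> \bar R) (x : H).
Local Open Scope ereal_scope.

Definition proper h : Prop :=
  (forall x, h x != -oo) /\ (exists x, h x < +oo).

(* Here [0 * +oo = 0], so the endpoints t = 0, 1 impose nothing. *)
Definition econvex h : Prop := forall x y (t : R), (0 <= t <= 1)%R ->
  h (t *: x + (1 - t) *: y)%R <= t%:E * h x + (1 - t)%:E * h y.

Definition proper_convex_lsc h : Prop :=
  [/\ proper h, econvex h & lower_semicontinuous h].

(* Used for proper [h]; it is then empty outside the domain of [h]. *)
Definition subdifferential h x : set H :=
  [set p | forall y, h x + (inner p (y - x)%R)%:E <= h y].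

Definition fenchel_conjugate h : H -> \bar R :=
  fun p => ereal_sup [set (inner x p)%:E - h x | x in [set: H]].

Definition prox_objective (tau : R) h x : H -> \bar R :=
  fun u => tau%:E * h u + (2^-1 * `|u - x| ^+ 2)%:E.

(* For proper convex lower semicontinuous [h] and tau > 0 the minimizer exists
   and is unique, so the default value 0 is then never used. *)
Definition prox (tau : R) h x : H :=
  xget 0%R [set p | forall u,
    prox_objective tau h x p <= prox_objective tau h x u].

End convex_analysis.

Section primal_dual_solution.
Context {R : realType} {U V : hilbertType R}.

(* [- L^* v \in T u + \partial g u] and [v \in \partial f (L u)] *)
Definition primal_dual_solution (T : U -> U) (L : U -> V)
    (f : V -> \bar R) (g : U -> \bar R) (u : U) (v : V) : Prop :=
  [set T u + p | p in subdifferential g u] (- adjoint L v) /\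
  subdifferential f (L u) v.

End primal_dual_solution.

Section convergence.
Context {R : realType} {H : hilbertType R}.

Definition weakly_converges (x : nat -> H) (l : H) : Prop :=
  forall y, inner (x n) y @[n --> \oo] --> inner l y.

Definition finite_dimensional : Prop :=
  exists (d : nat) (e : 'I_d -> H), forall x, exists c : 'I_d -> R,
    x = \sum_(i < d) c i *: e i.

End convergence.
Arguments finite_dimensional {R} H.

(* Main.v *)
Require Import Defs.
From HB Require Import structures.
From mathcomp Require Import all_boot all_order all_algebra.
From mathcomp Require Import all_classical all_reals all_analysis.
From mathcomp Require Import ring lra.
Import Order.TTheory GRing.Theory Num.Theory.
Import numFieldNormedType.Exports.
Local Open Scope classical_set_scope.
Local Open Scope ring_scope.

(** The proof combines an energy estimate with Opial's lemma.

    Every proximal step is an inclusion: the primal step gives a subgradient of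
    [g] at [uk n k] ([prox_subdifferential]), and by Moreau's decomposition the
    dual step gives a point at which [v n k.+1] is a subgradient of [f]
    ([prox_fenchel_conjugate]). Comparing these inclusions with those of a
    primal-dual solution (uh, vh), one inner iteration satisfies [energy_step]:
    the weighted squared distance of the new dual point to [vh] plus the squared
    distance of the new primal point to [uh] is at most the same dual distance
    before the step plus the squared norm of the forward point (relative to
    [uh]), and the difference controls the residuals. The
    decisive ingredient is cyclic monotonicity of the subdifferential of [g]
    over the solution and two successive inner points; plain monotonicity loses
    a cross term. The sum over the inner iterations telescopes in the dual
    variable, Jensen's inequality ([average_norm_sq]) handles the average that
    defines the next iterate, and cocoercivity ([forward_step]) bounds the
    forward point. So, up to the inertial perturbation, the energy
    kmax |u n - uh|^2 + kappa |v n 0 - vh|^2 decreases. The perturbation is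
    summable, so the energy converges and the residuals tend to 0
    ([quasi_fejer], [energy_cvg]). In particular the iterates are bounded.

    It remains to identify weak limit points. Along any ultrafilter on the
    indices the bounded iterates have a weak limit ([bounded_weak_cvg]). That
    limit is a solution: the sum of the two monotonicity inequalities passes to
    the limit, and Minty's argument with proximal points concludes
    ([limit_point_solution]). Since the energy converges at every solution, all
    these weak limits coincide ([opial]), which is weak convergence of the whole
    sequence. In finite dimension it is strong convergence
    ([finite_dimensional_weak_cvg]).

    Existence of proximal points is proved for every proper convex lower
    semicontinuous function by uniform convexity ([prox_objective_minimum]). It
    also yields the Riesz representation theorem ([riesz]), hence the adjoint of
    [L] and the weak limits above. *)

Set Implicit Arguments.
Unset Strict Implicit.
Unset Printing Implicit Defensive.

(** * Inner products *)

Section inner_product.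
Context {R : realType} {H : hilbertType R}.
Implicit Types (x y z : H) (a : R).

Lemma innerDr x y z : inner x (y + z) = inner x y + inner x z.
Proof. by rewrite innerC innerDl !(innerC x). Qed.

Lemma innerZr a x y : inner x (a *: y) = a * inner x y.
Proof. by rewrite innerC innerZl innerC. Qed.

Lemma innerNl x y : inner (- x) y = - inner x y.
Proof. by rewrite -scaleN1r innerZl mulN1r. Qed.

Lemma innerNr x y : inner x (- y) = - inner x y.
Proof. by rewrite innerC innerNl innerC. Qed.

Lemma innerBl x y z : inner (x - y) z = inner x z - inner y z.
Proof. by rewrite innerDl innerNl. Qed.

Lemma innerBr x y z : inner x (y - z) = inner x y - inner x z.
Proof. by rewrite innerDr innerNr. Qed.

Lemma inner0l x : inner 0 x = 0.
Proof. by rewrite -(scale0r 0) innerZl mul0r. Qed.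

Lemma inner0r x : inner x 0 = 0.
Proof. by rewrite innerC inner0l. Qed.

Lemma inner_suml (I : Type) (r : seq I) (x : I -> H) (y : H) :
  inner (\sum_(i <- r) x i) y = \sum_(i <- r) inner (x i) y.
Proof.
by elim/big_ind2: _ => [|x1 x2 y1 y2 <- <-|//]; [exact: inner0l|exact: innerDl].
Qed.

Definition innerE := (@innerDl R H, innerDr, innerBl, innerBr, innerNl, innerNr,
  @innerZl R H, innerZr, inner0l, inner0r).

Lemma inner_ge0 x : 0 <= inner x x.
Proof. by rewrite inner_norm sqr_ge0. Qed.

(** Turns an identity between vectors into one between real numbers, which
    [ring] and [field] decide once [innerE] has expanded the inner products. *)
Lemma inner_inj x y : (forall z, inner x z = inner y z) -> x = y.
Proof.
move=> eqxy; apply/eqP; rewrite -subr_eq0 -normr_eq0 -sqrf_eq0 -inner_norm.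
by rewrite innerBl eqxy subrr.
Qed.

Lemma norm_sq_le0 x : `|x| ^+ 2 <= 0 -> x = 0.
Proof.
by rewrite real_exprn_even_le0 ?normr_real//= normr_eq0 => /eqP.
Qed.

Lemma norm_sqB x y :
  `|x - y| ^+ 2 = `|x| ^+ 2 - 2 * inner x y + `|y| ^+ 2.
Proof. by rewrite -!inner_norm !innerE (innerC y x); ring. Qed.

Lemma norm_sqD x y :
  `|x + y| ^+ 2 = `|x| ^+ 2 + 2 * inner x y + `|y| ^+ 2.
Proof. by rewrite -!inner_norm !innerE (innerC y x); ring. Qed.

(** Expanding the square of |y| x - |x| y gives the bound from above without
    dividing; the other sign follows by replacing x with -x. *)
Lemma cauchy_schwarz x y : `|inner x y| <= `|x| * `|y|.
Proof.
have half : forall z, inner z y <= `|z| * `|y|.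
  move=> z; have [->|z0] := eqVneq z 0; first by rewrite inner0l normr0 mul0r.
  have [->|y0] := eqVneq y 0; first by rewrite inner0r normr0 mulr0.
  have np : 0 < `|z| by rewrite normr_gt0.
  have yp : 0 < `|y| by rewrite normr_gt0.
  have := inner_ge0 (`|y| *: z - `|z| *: y).
  rewrite !innerE !inner_norm (innerC y z) => le0.
  have {}le0 : 0 <= (`|z| * `|y|) * (`|z| * `|y| - inner z y) by nra.
  by move: le0; rewrite pmulr_rge0 ?mulr_gt0// subr_ge0.
rewrite ler_norml half andbT lerNl -innerNl.
by apply: le_trans (half _) _; rewrite normrN.
Qed.

End inner_product.

(** * Proximal points of convex functions *)

Lemma prox_is_minimizer (R : realType) (H : hilbertType R) (tau : R)
    (h : H -> \bar R) (x : H) :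
  (exists p, forall u,
    (prox_objective tau h x p <= prox_objective tau h x u)%E) ->
  forall u, (prox_objective tau h x (prox tau h x) <= prox_objective tau h x u)%E.
Proof.
exact: (@xgetPex _ 0 [set p | forall u,
  (prox_objective tau h x p <= prox_objective tau h x u)%E]).
Qed.

Section convex_minimization.
Context {R : realType} {H : hilbertType R}.
Variable h : H -> \bar R.
Hypothesis h_pcl : proper_convex_lsc h.

Let fin_dom {y} : (h y < +oo)%E -> h y = (fine (h y))%:E.
Proof.
case: h_pcl => -[hN _] _ _ yfin; rewrite fineK// fin_numE hN/=.
by rewrite -ltey.
Qed.

(** Convexity as an inequality between real numbers, available on the domain
    of [h] because the domain is convex. *)
Lemma convex_fine a b (t : R) : (h a < +oo)%E -> (h b < +oo)%E ->
  0 <= t <= 1 ->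
  (h (t *: a + (1 - t) *: b)%R < +oo)%E /\
  fine (h (t *: a + (1 - t) *: b)) <= t * fine (h a) + (1 - t) * fine (h b).
Proof.
move=> ha hb t01; case: (h_pcl) => _ hc _.
have := hc a b t t01; rewrite [h a]fin_dom// [h b]fin_dom// -!EFinM -EFinD => le.
have fin : (h (t *: a + (1 - t) *: b)%R < +oo)%E by apply: le_lt_trans le (ltry _).
by split=> //; move: le; rewrite [in X in X -> _]fin_dom// lee_fin.
Qed.

(** Lower semicontinuity at a point [x0] of the domain bounds [h] below on a
    small ball around [x0]; along each ray from [x0] convexity carries this
    bound outside the ball at the price of a term linear in the distance. *)
Lemma convex_lsc_linear_minorant : exists c d x0, 0 <= d /\
  forall y, (h y < +oo)%E -> c - d * `|y - x0| <= fine (h y).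
Proof.
case: (h_pcl) => -[hN [x0 hx0]] hc hl.
have [V Vx0 Vh] : exists2 V, nbhs x0 V &
    forall y, V y -> ((fine (h x0) - 1)%:E < h y)%E.
  by apply: hl; rewrite [h x0]fin_dom// lte_fin; lra.
have /nbhs_ballP[r /= r0 rV] := Vx0.
exists (fine (h x0) - 1), (2 / r), x0; split; first by rewrite divr_ge0// ltW.
move=> y hy; have [yr|yr] := ltP `|y - x0| r.
  have : V y by apply: rV; rewrite -ball_normE /= distrC.
  move=> /Vh; rewrite [h y]fin_dom// lte_fin => /ltW le.
  apply: le_trans le; rewrite lerBlDr lerDl.
  by rewrite mulr_ge0// divr_ge0// ltW.
have ynp : 0 < `|y - x0| by apply: lt_le_trans r0 yr.
(* [t] moves [y] along the ray from [x0] to distance r / 2, inside the ball. *)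
pose t := r / (2 * `|y - x0|).
have tp : 0 < t by rewrite divr_gt0// mulr_gt0.
have t1 : t <= 1 by rewrite ler_pdivrMr ?mulr_gt0//; lra.
have t01 : 0 <= t <= 1 by rewrite t1 ltW.
have [fin le] := convex_fine hy hx0 t01.
have : V (t *: y + (1 - t) *: x0).
  apply: rV; rewrite -ball_normE /=.
  have -> : x0 - (t *: y + (1 - t) *: x0) = - (t *: (y - x0)).
    by apply: inner_inj => z; rewrite !innerE; ring.
  rewrite normrN normrZ gtr0_norm// /t.
  have -> : r / (2 * `|y - x0|) * `|y - x0| = r / 2 by field; rewrite gt_eqF.
  lra.
move=> /Vh; rewrite [h (_ + _)]fin_dom// lte_fin => lb.
have -> : 2 / r * `|y - x0| = t^-1.
  by rewrite /t; field; rewrite !gt_eqF.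
have : t * (fine (h x0) - t^-1) <= t * fine (h y).
  by rewrite mulrBr divff ?gt_eqF//; lra.
by rewrite ler_pM2l//; lra.
Qed.

Variables (tau : R) (x : H).
Hypothesis tau_gt0 : 0 < tau.

Let J u := tau * fine (h u) + 2^-1 * `|u - x| ^+ 2.

Lemma prox_objective_fine u : (h u < +oo)%E -> prox_objective tau h x u = (J u)%:E.
Proof. by move=> hu; rewrite /prox_objective [h u]fin_dom. Qed.

(* The quadratic term dominates the linear lower bound of [h]. *)
Let J_bounded_below : exists m : R, forall u, (h u < +oo)%E -> m <= J u.
Proof.
have [c [d [x0 [d0 hlow]]]] := convex_lsc_linear_minorant.
exists (tau * (c - d * `|x - x0|) - 2^-1 * (tau * d) ^+ 2) => u hu.
have : tau * (c - d * `|u - x0|) <= tau * fine (h u) by rewrite ler_pM2l// hlow.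
have : tau * d * `|u - x0| <= tau * d * (`|u - x| + `|x - x0|).
  by rewrite ler_wpM2l ?ler_distD// mulr_ge0// ltW.
have := sqr_ge0 (`|u - x| - tau * d); rewrite /J; nra.
Qed.

(* The parallelogram law makes the objective uniformly convex: near-minimizers
   are close to each other. *)
Let J_midpoint a b (m : R) : (forall u, (h u < +oo)%E -> m <= J u) ->
  (h a < +oo)%E -> (h b < +oo)%E ->
  `|a - b| ^+ 2 <= 4 * ((J a - m) + (J b - m)).
Proof.
move=> mJ ha hb; have half : (0 : R) <= (2^-1 : R) <= 1 by apply/andP; split; lra.
have [hc le] := convex_fine ha hb half.
have := mJ _ hc; rewrite /J.
pose c := 2^-1 *: a + (1 - 2^-1) *: b; rewrite -/c in hc le *.
have -> : `|c - x| ^+ 2 =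
    2^-1 * `|a - x| ^+ 2 + 2^-1 * `|b - x| ^+ 2 - 4^-1 * `|a - b| ^+ 2.
  by rewrite -!inner_norm /c !innerE (innerC b a) (innerC x a) (innerC x b); field.
have : tau * fine (h c) <= tau * (2^-1 * fine (h a) + (1 - 2^-1) * fine (h b)).
  by rewrite ler_pM2l.
lra.
Qed.

(** The sublevel sets of the objective above its infimum generate a Cauchy
    filter by uniform convexity, and lower semicontinuity shows that its limit
    attains the infimum. *)
Lemma prox_objective_minimum :
  exists p, forall u, (prox_objective tau h x p <= prox_objective tau h x u)%E.
Proof.
have [m0 m0J] := J_bounded_below; case: (h_pcl) => -[hN [x0 hx0]] hc hl.
pose A := [set J u | u in [set u | (h u < +oo)%E]].
have infA : has_inf A.
  by split; [exists (J x0); exists x0|exists m0 => _ [u hu <-]; exact: m0J].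
pose m := inf A.
have mJ u : (h u < +oo)%E -> m <= J u.
  by move=> hu; apply: inf_lbound; [case: infA|exists u].
pose S e := [set u | (h u < +oo)%E /\ J u < m + e].
pose F := filter_from [set e : R | 0 < e] S.
have FF : ProperFilter F.
  apply: filter_from_proper; last first.
    move=> e /= e0; have [_ [u hu <-] lt] := inf_adherent e0 infA.
    by exists u.
  apply: filter_from_filter; first by exists 1; rewrite /= ltr01.
  move=> e e' /= e0 e0'; exists (Order.min e e'); first by rewrite lt_min e0.
  move=> u [hu lt]; split; split=> //; apply: lt_le_trans lt _.
    by rewrite lerD2l ge_min lexx.
  by rewrite lerD2l ge_min lexx orbT.
have FS e : 0 < e -> F (S e) by move=> e0; exists e.
have cF : cauchy F.
  apply/cauchy_exP => e e0.
  pose d := e ^+ 2 / 8.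
  have d0 : 0 < d by rewrite divr_gt0// exprn_gt0.
  have [u [hu lu]] := filter_ex (FS _ d0).
  exists u; apply: filterS (FS _ d0) => w [hw lw].
  rewrite -ball_normE /= -(@ltr_pXn2r _ 2)// ?nnegrE ?normr_ge0 ?(ltW e0)//.
  apply: le_lt_trans (J_midpoint mJ hu hw) _.
  by rewrite /d in lu lw; lra.
have /cvg_ex[p Fp] : cvg F by exact: cauchy_cvg.
pose a0 := tau^-1 * (m - 2^-1 * `|p - x| ^+ 2).
(* [a0] is the value of [h p] at which the objective equals the infimum [m]. *)
have hp : (h p <= a0%:E)%E.
  rewrite leNgt; apply/negP => lt.
  have [a aa0 ap] : exists2 a, a0 < a & (a%:E < h p)%E.
    move: lt (hN p); case: (h p) => [r| |]//.
      by rewrite lte_fin => ar _; exists ((a0 + r) / 2); rewrite ?lte_fin; lra.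
    by move=> _ _; exists (a0 + 1); [lra|exact: ltry].
  have [W Wp Wh] := hl p a ap.
  pose e := tau * (a - a0) / 2.
  have e0 : 0 < e by rewrite divr_gt0// mulr_gt0// subr_gt0.
  have nrm : (fun u => `|u - x| ^+ 2) @ F --> `|p - x| ^+ 2.
    have c1 : (fun u => `|u - x|) @ F --> `|p - x|.
      by apply: cvg_norm; apply: cvgB => //; exact: cvg_cst.
    by rewrite expr2; apply: cvgM.
  have nrm2 : \forall u \near F, `|p - x| ^+ 2 - e < `|u - x| ^+ 2.
    by apply: (cvgr_gt _ nrm); lra.
  have [u [[hu lu] Wu lnu]] : exists u,
      [/\ S e u, W u & `|p - x| ^+ 2 - e < `|u - x| ^+ 2].
    have [u [[? ?] ?]] := filter_ex (filterI (filterI (FS _ e0) (Fp _ Wp)) nrm2).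
    by exists u.
  have := Wh _ Wu; rewrite [h u]fin_dom// lte_fin => au.
  have : tau * a < tau * fine (h u) by rewrite ltr_pM2l.
  have -> : tau * a = tau * a0 + 2 * e by rewrite /e; field.
  have -> : tau * a0 = m - 2^-1 * `|p - x| ^+ 2 by rewrite /a0 mulVKf// gt_eqF.
  move: lu; rewrite /J; lra.
have hpy : (h p < +oo)%E by apply: le_lt_trans hp (ltry _).
exists p => u; have [hu|] := ltP (h u) +oo%E; last first.
  rewrite leye_eq => /eqP hu; rewrite {2}/prox_objective hu.
  by rewrite gt0_muley ?lte_fin// addye// leey.
rewrite !prox_objective_fine// lee_fin; apply: le_trans (mJ _ hu).
move: hp; rewrite [h p]fin_dom// lee_fin => hp.
have : tau * fine (h p) <= tau * a0 by rewrite ler_pM2l.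
have -> : tau * a0 = m - 2^-1 * `|p - x| ^+ 2 by rewrite /a0 mulVKf// gt_eqF.
rewrite /J; lra.
Qed.

Let p := prox tau h x.

Lemma prox_min u : (prox_objective tau h x p <= prox_objective tau h x u)%E.
Proof.
exact: prox_is_minimizer prox_objective_minimum u.
Qed.

Lemma prox_fin : (h p < +oo)%E.
Proof.
case: (h_pcl) => -[_ [x0 hx0]] _ _; rewrite ltNge leye_eq; apply/negP => /eqP hp.
have := prox_min x0; rewrite (prox_objective_fine hx0) /prox_objective hp.
by rewrite gt0_muley ?lte_fin// addye.
Qed.

(** Fermat's rule: compare [p] with the points t y + (1 - t) p, divide by [t]
    and let [t] tend to 0. *)
Lemma prox_subdifferential : subdifferential h p (tau^-1 *: (x - p)).
Proof.
move=> y; have [hy|] := ltP (h y) +oo%E; last first.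
  by rewrite leye_eq => /eqP ->; exact: leey.
have hp := prox_fin.
rewrite [h p]fin_dom// [h y]fin_dom// -EFinD lee_fin innerZl.
rewrite -(ler_pM2l tau_gt0) mulrDr mulVKf ?gt_eqF//.
apply/ler_addgt0Pl => e e0.
pose D := `|y - p| ^+ 2.
have D0 : 0 <= D by rewrite sqr_ge0.
(* Chosen so that t <= 1 and t * D <= e, also when D = 0. *)
pose t := e / (e + D).
have eD : 0 < e + D by rewrite ltr_pwDl.
have tp : 0 < t by rewrite divr_gt0.
have t1 : t <= 1 by rewrite ler_pdivrMr// mul1r lerDl.
have tD : t * D <= e by rewrite /t mulrAC ler_pdivrMr// ler_pM2l// lerDr ltW.
have t01 : 0 <= t <= 1 by rewrite t1 ltW.
have [fin le] := convex_fine hy hp t01.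
have := prox_min (t *: y + (1 - t) *: p).
rewrite !prox_objective_fine// lee_fin /J.
have -> : t *: y + (1 - t) *: p - x = (p - x) + t *: (y - p).
  by apply: inner_inj => z; rewrite !innerE; ring.
rewrite (norm_sqD (p - x)) normrZ exprMn (gtr0_norm tp) innerZr -/D.
rewrite -(opprB x p) innerNl => h1.
have : tau * fine (h (t *: y + (1 - t) *: p)) <=
    tau * (t * fine (h y) + (1 - t) * fine (h p)).
  by rewrite ler_pM2l.
move=> h2.
have : t * (tau * fine (h p) + inner (x - p) (y - p)) <= t * (e + tau * fine (h y)).
  have : t * (t * D) <= t * e by rewrite ler_pM2l.
  nra.
by rewrite ler_pM2l.
Qed.

End convex_minimization.

(** * Subgradients *)

Section subgradients.
Context {R : realType} {H : hilbertType R}.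
Variable h : H -> \bar R.
Hypothesis h_proper : Defs.proper h.
Implicit Types x y p q : H.

Lemma subdifferential_fin x p : subdifferential h x p -> h x = (fine (h x))%:E.
Proof.
case: h_proper => hN [x0 hx0] /(_ x0) le; rewrite fineK// fin_numE hN/=.
apply/eqP => hx; move: le; rewrite hx addye// leye_eq => /eqP hx0'.
by move: hx0; rewrite hx0'.
Qed.

Lemma subdifferential_le x y p q :
  subdifferential h x p -> subdifferential h y q ->
  fine (h x) + inner p (y - x) <= fine (h y).
Proof.
move=> hx hy; have := hx y.
by rewrite (subdifferential_fin hx) (subdifferential_fin hy) -EFinD lee_fin.
Qed.

Lemma subdifferential_monotone x y p q :
  subdifferential h x p -> subdifferential h y q ->
  0 <= inner (p - q) (x - y).
Proof.
move=> hx hy; have := subdifferential_le hx hy; have := subdifferential_le hy hx.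
by rewrite !innerE; lra.
Qed.

(** Cyclic monotonicity over three points, which is stronger than monotonicity:
    it retains information on the values of [h], and the energy estimate below
    depends on it. *)
Lemma subdifferential_cyclic x y z p q r :
  subdifferential h x p -> subdifferential h y q -> subdifferential h z r ->
  inner p (y - x) + inner q (z - y) + inner r (x - z) <= 0.
Proof.
move=> hx hy hz; have := subdifferential_le hx hy.
have := subdifferential_le hy hz; have := subdifferential_le hz hx; lra.
Qed.

End subgradients.

Section prox_characterization.
Context {R : realType} {H : hilbertType R}.

(** A subgradient turns the objective into a function that grows quadratically
    away from [p], so no other point can be a minimizer. *)
Lemma prox_unique (h : H -> \bar R) (tau c : R) (x p q : H) : 0 < tau ->
  h p = c%:E -> subdifferential h p q -> x - p = tau *: q ->
  prox tau h x = p.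
Proof.
move=> tau0 hp hq xpq.
have low u : ((tau * c + 2^-1 * `|p - x| ^+ 2 + 2^-1 * `|u - p| ^+ 2)%:E
    <= prox_objective tau h x u)%E.
  have := hq u; rewrite hp /prox_objective; case: (h u) => [s| |].
  - rewrite -EFinD -EFinM -EFinD !lee_fin => le.
    have : tau * (c + inner q (u - p)) <= tau * s by rewrite ler_pM2l.
    have : tau * inner q (u - p) = inner (x - p) (u - p) by rewrite xpq innerZl.
    have -> : u - x = (u - p) - (x - p) by apply: inner_inj => z; rewrite !innerE; ring.
    rewrite -(opprB x p) normrN (norm_sqB (u - p)) (innerC (x - p)); lra.
  - by move=> _; rewrite gt0_muley ?lte_fin// addye// leey.
  - by rewrite -EFinD leeNy_eq.
have obj_p : prox_objective tau h x p = (tau * c + 2^-1 * `|p - x| ^+ 2)%:E.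
  by rewrite /prox_objective hp.
have pmin u : (prox_objective tau h x p <= prox_objective tau h x u)%E.
  apply: le_trans (low u); rewrite obj_p lee_fin lerDl.
  by rewrite mulr_ge0// ?invr_ge0// sqr_ge0.
have /(_ p) := prox_is_minimizer (ex_intro _ p pmin).
rewrite obj_p => /(le_trans (low _)); rewrite lee_fin => le0.
apply/eqP; rewrite -subr_eq0; apply/eqP/norm_sq_le0; lra.
Qed.

(** Moreau's decomposition: if [q] is the proximal point of [s^-1 f] at
    [s^-1 w], then [r = w - s q] is a subgradient of [f] at [q], so [q] is a
    subgradient of the conjugate at [r] and [r] is the proximal point of the
    conjugate at [w]. The dual update thus becomes an inclusion for [f]
    itself. *)
Lemma prox_fenchel_conjugate (f : H -> \bar R) (s : R) (w : H) :
  proper_convex_lsc f -> 0 < s ->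
  subdifferential f (s^-1 *: (w - prox s (fenchel_conjugate f) w))
    (prox s (fenchel_conjugate f) w).
Proof.
move=> fpcl s0; have si0 : 0 < s^-1 by rewrite invr_gt0.
pose q := prox s^-1 f (s^-1 *: w).
have fr := prox_subdifferential fpcl (s^-1 *: w) si0; rewrite -/q invrK in fr.
set r := s *: _ in fr.
have [f_proper _ _] := fpcl.
have fq := subdifferential_fin f_proper fr.
set c := fine (f q) in fq.
have conj_r : fenchel_conjugate f r = (inner q r - c)%:E.
  apply/eqP; rewrite eq_le; apply/andP; split; last first.
    by apply: ereal_sup_ubound; exists q => //; rewrite fq.
  apply: ge_ereal_sup => _ [y _ <-].
  have := fr y; rewrite fq; case: (f y) => [t| |].
  - rewrite -EFinD -EFinB !lee_fin innerBr (innerC q) (innerC y); lra.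
  - by move=> _; rewrite /= leNye.
  - by rewrite -EFinD leeNy_eq.
have sub_r : subdifferential (fenchel_conjugate f) r q.
  move=> y; rewrite conj_r -EFinD; apply: ereal_sup_ubound.
  by exists q => //; rewrite fq -EFinB innerBr; congr _%:E; ring.
have wr : w - r = s *: q.
  by rewrite /r scalerBr scalerA divff ?gt_eqF// scale1r subKr.
rewrite (prox_unique s0 conj_r sub_r wr) wr scalerA mulVf ?gt_eqF// scale1r.
exact: fr.
Qed.

End prox_characterization.

(** * Riesz representation and adjoints *)

Section riesz.
Context {R : realType} {H : hilbertType R}.

(** A bounded linear functional is convex and lower semicontinuous; its proximal
    point at 0 is minus the representing vector. *)
Lemma riesz (phi : H -> R) (M : R) :
  (forall x y, phi (x + y) = phi x + phi y) ->
  (forall a x, phi (a *: x) = a * phi x) ->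
  (forall x, `|phi x| <= M * `|x|) ->
  exists w, forall x, phi x = inner x w.
Proof.
move=> phiD phiZ phi_le.
have phi_pcl : proper_convex_lsc (fun x => (phi x)%:E).
  split; first by split=> //; exists 0; exact: ltry.
    by move=> x y t _; rewrite phiD !phiZ.
  move=> x a; rewrite lte_fin => ax.
  have M1 : 0 < `|M| + 1 by rewrite ltr_wpDl.
  exists (ball x ((phi x - a) / (`|M| + 1))).
    by apply: nbhsx_ballx; rewrite divr_gt0// subr_gt0.
  move=> y; rewrite -ball_normE /= ltr_pdivlMr// lte_fin => xy.
  have : phi (x - y) <= `|x - y| * (`|M| + 1).
    apply: le_trans (ler_norm _) _; apply: le_trans (phi_le _) _.
    rewrite mulrC ler_wpM2l//; have := ler_norm M; lra.
  have -> : phi (x - y) = phi x - phi y by rewrite -scaleN1r phiD phiZ mulN1r.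
  lra.
pose p := prox 1 (fun x => (phi x)%:E) 0.
have sub := prox_subdifferential phi_pcl 0 ltr01; rewrite -/p in sub.
have le d : - inner d p <= phi d.
  have := sub (p + d); rewrite -EFinD lee_fin phiD invr1 scale1r sub0r.
  by rewrite (addrC p) addrK innerNl (innerC p); lra.
exists (- p) => x; have := le x; have := le (-1 *: x).
by rewrite phiZ innerZl innerNr; lra.
Qed.

End riesz.

Section adjoint.
Context {R : realType} {U V : hilbertType R}.
Variable L : {linear U -> V}.
Hypothesis L_bounded : bounded_fun_norm L.

Lemma opnorm_has_sup : has_sup [set `|L x| | x in [set x : U | `|x| <= 1]].
Proof.
split; first by exists `|L 0|; exists 0 => //=; rewrite normr0.
by have [M LM] := L_bounded 1; exists M => _ [x x1 <-]; exact: LM.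
Qed.

Lemma opnorm_ge0 : 0 <= opnorm L.
Proof.
apply: (sup_upper_bound opnorm_has_sup).
by exists 0; rewrite /= ?linear0 normr0.
Qed.

Lemma le_opnorm x : `|L x| <= opnorm L * `|x|.
Proof.
have [->|x0] := eqVneq x 0; first by rewrite linear0 !normr0 mulr0.
have xp : 0 < `|x| by rewrite normr_gt0.
rewrite -ler_pdivrMr//; apply: (sup_upper_bound opnorm_has_sup).
exists (`|x|^-1 *: x); last by rewrite linearZ/= normrZ ger0_norm ?invr_ge0// mulrC.
by rewrite /= normrZ ger0_norm ?invr_ge0// mulVf ?gt_eqF.
Qed.

Lemma adjointE x y : inner (L x) y = inner x (adjoint L y).
Proof.
have ex : exists w, forall x, inner (L x) y = inner x w; last first.
  exact: (@xgetPex _ 0 [set w | forall x, inner (L x) y = inner x w] ex x).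
apply: (@riesz _ _ (fun x => inner (L x) y) (opnorm L * `|y|)).
- by move=> z z'; rewrite linearD innerDl.
- by move=> a z; rewrite linearZ innerZl.
- move=> z; apply: le_trans (cauchy_schwarz _ _) _.
  by rewrite mulrAC ler_wpM2r// le_opnorm.
Qed.

End adjoint.

(** * Weak convergence along ultrafilters *)

Section ultrafilter_limits.
Context {R : realType} {I : Type}.

Lemma bounded_ultra_cvg (G : set_system I) (f : I -> R) (M : R) :
  UltraFilter G -> (forall i, `|f i| <= M) -> exists l : R, f @ G --> l.
Proof.
move=> GU fM; have GP : ProperFilter G by exact: ultra_proper.
have fG : (f @ G) `[- M, M]%classic.
  change (G (f @^-1` `[- M, M]%classic)); apply: filterE => i.
  by rewrite /= in_itv/= -ler_norml.
have [l [_ lcl]] := segment_compact _ fG.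
exists l => B Bl; have [//|nB] := in_ultra_setVsetC (f @^-1` B) GU.
have [y [nBy By]] := lcl (~` B) B nB Bl; by [].
Qed.

(** If [f] stayed at distance at least [e] from [l] on a set that meets every
    element of [F], an ultrafilter containing that set would contradict the
    hypothesis. *)
Lemma cvg_ultra (F : set_system I) (f : I -> R) (l : R) : ProperFilter F ->
  (forall G, UltraFilter G -> F `<=` G -> f @ G --> l) -> f @ F --> l.
Proof.
move=> FF fG; apply/cvgrPdist_lt => e e0; apply: contrapT => nF.
pose A := [set i | `|l - f i| < e].
have wF : ProperFilter (within (~` A) F).
  apply: Build_ProperFilter => /= w0; apply: nF.
  apply: (filterS _ (w0 : F [set i | (~` A) i -> set0 i])) => i nA.
  by apply: contrapT => /nA.
have [G [GU wG]] := ultraFilterLemma wF.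
have GP : ProperFilter G by exact: ultra_proper.
have FG : F `<=` G by move=> B FB; apply: wG; apply: filterS FB.
have GA : G A by have /cvgrPdist_lt/(_ e e0) := fG G GU FG.
have GnA : G (~` A) by apply: wG; rewrite /within/=; apply: filterE.
by have [i []] := filter_ex (filterI GA GnA).
Qed.

Lemma cvg_le_cst (F : set_system I) {FF : ProperFilter F} (f : I -> R) (l c : R) :
  f @ F --> l -> (forall i, f i <= c) -> l <= c.
Proof.
move=> fl fc; apply: (closed_cvg (fun r => r <= c) (@closed_le _ c) _ _ fl).
exact: filterE.
Qed.

End ultrafilter_limits.

(** [weakly_converges] is the case of the Frechet filter on [nat]. *)
Definition weak_cvg {R : realType} {H : hilbertType R} {I : Type}
    (F : set_system I) (z : I -> H) (x : H) :=
  forall y, inner (z i) y @[i --> F] --> inner x y.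

Section weak_convergence.
Context {R : realType} {H : hilbertType R} {I : Type}.
Implicit Types (F : set_system I) (z t : I -> H).

(** Weak compactness of balls. Along an ultrafilter every bounded family of
    inner products converges, and the limits form a bounded linear functional,
    which the Riesz theorem represents. *)
Lemma bounded_weak_cvg F z (M : R) : UltraFilter F ->
  (forall i, `|z i| <= M) -> exists x, weak_cvg F z x.
Proof.
move=> FU zM; have FP : ProperFilter F by exact: ultra_proper.
have bnd y i : `|inner (z i) y| <= M * `|y|.
  by apply: le_trans (cauchy_schwarz _ _) _; rewrite ler_wpM2r.
have /boolp.choice[phi phiP] :
    forall y, exists l : R, inner (z i) y @[i --> F] --> l.
  by move=> y; exact: bounded_ultra_cvg (bnd y).
have [w wP] : exists w, forall y, phi y = inner y w.
  apply: (@riesz _ _ phi M).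
  - move=> x y.
    have lim : inner (z i) (x + y) @[i --> F] --> phi x + phi y.
      by under eq_cvg do rewrite innerDr; apply: cvgD.
    exact: norm_cvg_unique (phiP _) lim.
  - move=> a x.
    have lim : inner (z i) (a *: x) @[i --> F] --> a * phi x.
      by under eq_cvg do rewrite innerZr; apply: cvgM => //; exact: cvg_cst.
    exact: norm_cvg_unique (phiP _) lim.
  - by move=> y; apply: cvg_le_cst (cvg_norm (phiP y)) (bnd y).
by exists w => y; rewrite innerC -wP.
Qed.

Lemma inner_cvg0 F {FF : Filter F} z t (M : R) : (forall i, `|z i| <= M) ->
  t @ F --> 0 -> inner (z i) (t i) @[i --> F] --> (0 : R).
Proof.
move=> zM t0; apply/cvgr0Pnorm_lt => e e0.
have M1 : 0 < `|M| + 1 by rewrite ltr_wpDl.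
have eM : 0 < e / (`|M| + 1) by rewrite divr_gt0.
have /cvgr0Pnorm_lt/(_ _ eM) := t0; apply: filterS => i /=.
rewrite ltr_pdivlMr// => lt; apply: le_lt_trans lt.
apply: le_trans (cauchy_schwarz _ _) _; rewrite mulrC ler_wpM2l//.
by apply: le_trans (zM i) _; have := ler_norm M; lra.
Qed.

Lemma weak_cvgB0 F {FF : Filter F} z t x : weak_cvg F z x -> t @ F --> 0 ->
  weak_cvg F (fun i => z i - t i) x.
Proof.
move=> zx t0 y; under eq_cvg do rewrite innerBl (innerC (t _)).
rewrite -[inner x y]subr0; apply: cvgB; first exact: zx.
exact: (inner_cvg0 (z := fun=> y) (M := `|y|)).
Qed.

End weak_convergence.

(** * Opial's lemma in a product *)

Section opial.
Context {R : realType} {U V : hilbertType R}.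
Variables (a b : R) (u : nat -> U) (v : nat -> V) (S : U -> V -> Prop) (M : R).
Hypothesis (a_gt0 : 0 < a) (b_gt0 : 0 < b).
Hypothesis u_bounded : forall n, `|u n| <= M.
Hypothesis v_bounded : forall n, `|v n| <= M.
Hypothesis energy_cvg : forall x y, S x y ->
  exists l : R, a * `|u n - x| ^+ 2 + b * `|v n - y| ^+ 2 @[n --> \oo] --> l.
Hypothesis limit_point_S : forall G x y, UltraFilter G -> \oo `<=` G ->
  weak_cvg G u x -> weak_cvg G v y -> S x y.

(** The difference of the energies at two limit points is affine in the
    iterates, so it has the same limit along both ultrafilters; evaluating that
    limit at either point gives opposite signs of the same squared distance. *)
Lemma weak_limit_point_unique G1 G2 x1 x2 y1 y2 :
  UltraFilter G1 -> UltraFilter G2 -> \oo `<=` G1 -> \oo `<=` G2 ->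
  weak_cvg G1 u x1 -> weak_cvg G1 v y1 ->
  weak_cvg G2 u x2 -> weak_cvg G2 v y2 -> x1 = x2 /\ y1 = y2.
Proof.
move=> U1 U2 le1 le2 ux1 vy1 ux2 vy2.
have P1 : ProperFilter G1 by exact: ultra_proper.
have P2 : ProperFilter G2 by exact: ultra_proper.
have [l1 cl1] := energy_cvg (limit_point_S U1 le1 ux1 vy1).
have [l2 cl2] := energy_cvg (limit_point_S U2 le2 ux2 vy2).
pose D n := 2 * a * inner (u n) (x2 - x1) + 2 * b * inner (v n) (y2 - y1).
pose c := a * (`|x1| ^+ 2 - `|x2| ^+ 2) + b * (`|y1| ^+ 2 - `|y2| ^+ 2).
have Dcvg : D @ \oo --> l1 - l2 - c.
  rewrite (_ : D = (fun n => (a * `|u n - x1| ^+ 2 + b * `|v n - y1| ^+ 2) -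
     (a * `|u n - x2| ^+ 2 + b * `|v n - y2| ^+ 2) - c)); last first.
    by apply/funext => n; rewrite /D /c !norm_sqB !innerBr; ring.
  by apply: cvgB; [exact: cvgB|exact: cvg_cst].
have Dlim G x y : ProperFilter G -> weak_cvg G u x -> weak_cvg G v y ->
    D @ G --> 2 * a * inner x (x2 - x1) + 2 * b * inner y (y2 - y1).
  move=> GP ux vy; apply: cvgD; apply: cvgM; do ?[exact: cvg_cst|exact: ux|exact: vy].
have D1 : D @ G1 --> l1 - l2 - c by move=> B /Dcvg; exact: le1.
have D2 : D @ G2 --> l1 - l2 - c by move=> B /Dcvg; exact: le2.
have e : 2 * a * inner x1 (x2 - x1) + 2 * b * inner y1 (y2 - y1) =
    2 * a * inner x2 (x2 - x1) + 2 * b * inner y2 (y2 - y1).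
  rewrite -(norm_cvg_unique D1 (Dlim G1 x1 y1 _ ux1 vy1)).
  exact: (norm_cvg_unique D2 (Dlim G2 x2 y2 _ ux2 vy2)).
have sum0 : a * `|x2 - x1| ^+ 2 + b * `|y2 - y1| ^+ 2 = 0.
  rewrite -!inner_norm [inner (x2 - x1) _]innerBl [inner (y2 - y1) _]innerBl.
  lra.
have x_ge0 : 0 <= a * `|x2 - x1| ^+ 2 by rewrite mulr_ge0 ?sqr_ge0 ?(ltW a_gt0).
have y_ge0 : 0 <= b * `|y2 - y1| ^+ 2 by rewrite mulr_ge0 ?sqr_ge0 ?(ltW b_gt0).
split; apply/esym/eqP; rewrite -subr_eq0; apply/eqP/norm_sq_le0.
  by rewrite -(pmulr_rle0 _ a_gt0); lra.
by rewrite -(pmulr_rle0 _ b_gt0); lra.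
Qed.

(** Every ultrafilter finer than the Frechet filter has a weak limit, and all
    these limits agree. *)
Lemma opial : exists x y,
  [/\ S x y, weakly_converges u x & weakly_converges v y].
Proof.
have [G [GU leG]] := @ultraFilterLemma nat \oo _.
have [x ux] := bounded_weak_cvg GU u_bounded.
have [y vy] := bounded_weak_cvg GU v_bounded.
exists x, y; split; first exact: limit_point_S vy.
  move=> z; apply: cvg_ultra => G' GU' leG'.
  have [x' ux'] := bounded_weak_cvg GU' u_bounded.
  have [y' vy'] := bounded_weak_cvg GU' v_bounded.
  have [-> _] := weak_limit_point_unique GU GU' leG leG' ux vy ux' vy'.
  exact: ux'.
move=> z; apply: cvg_ultra => G' GU' leG'.
have [x' ux'] := bounded_weak_cvg GU' u_bounded.
have [y' vy'] := bounded_weak_cvg GU' v_bounded.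
have [_ ->] := weak_limit_point_unique GU GU' leG leG' ux vy ux' vy'.
exact: vy'.
Qed.

End opial.

(** * Finite dimension *)

Section finite_dimension.
Context {R : realType} {H : hilbertType R}.

(** Gram-Schmidt, one spanning vector at a time. Vectors that add nothing to the
    span contribute 0, so the family is a tight frame rather than an orthonormal
    basis; such a frame is enough to recover a vector from finitely many inner
    products. *)
Lemma finite_dimensional_frame : finite_dimensional H ->
  exists (m : nat) (b : nat -> H), forall x,
    x = \sum_(i < m) inner x (b i) *: b i.
Proof.
case=> d [e eP].
pose proj (m : nat) (b : nat -> H) x := \sum_(i < m) inner x (b i) *: b i.
have projD m b x y : proj m b (x + y) = proj m b x + proj m b y.
  by rewrite /proj -big_split/=; apply: eq_bigr => i _; rewrite innerDl scalerDl.
have projZ m b c x : proj m b (c *: x) = c *: proj m b x.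
  by rewrite /proj scaler_sumr; apply: eq_bigr => i _; rewrite innerZl scalerA.
have proj0 m b : proj m b 0 = 0.
  by rewrite /proj big1// => i _; rewrite inner0l scale0r.
have proj_sym m b x y : inner (proj m b x) y = inner x (proj m b y).
  rewrite /proj (innerC x) !inner_suml; apply: eq_bigr => i _.
  by rewrite !innerZl (innerC (b i) y) (innerC (b i) x) mulrC.
suff /(_ d)[m [b [bE _]]] : forall k, exists m b,
    (forall i : 'I_d, (i < k)%N -> proj m b (e i) = e i) /\
    (forall i, (i < m)%N -> proj m b (b i) = b i).
  exists m, b => x; have [c ->] := eP x; rewrite -/(proj m b _).
  elim/big_ind: _ => [|y z yE zE|i _].
  - by rewrite proj0.
  - by rewrite projD -yE -zE.
  - by rewrite projZ bE.
(* Induction on the number [k] of spanning vectors already fixed by the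
   projection; the projection also fixes its own frame vectors. *)
elim=> [|k [m [b [bE bb]]]].
  by exists 0%N, (fun=> 0).
have [dk|kd] := leqP d k.
  by exists m, b; split=> // i _; apply: bE; exact: leq_trans dk.
pose ek := e (Ordinal kd).
have proj_idem x : proj m b (proj m b x) = proj m b x.
  rewrite {2 3}/proj; elim/big_ind: _ => [|y z yE zE|i _].
  - by rewrite proj0.
  - by rewrite projD yE zE.
  - by rewrite projZ bb.
pose r := ek - proj m b ek.
have proj_r : proj m b r = 0.
  by rewrite /r -scaleN1r projD projZ proj_idem scaleN1r subrr.
pose n := `|r|^-1 *: r.
have proj_n : proj m b n = 0 by rewrite projZ proj_r scaler0.
pose b' i := if (i < m)%N then b i else n.
have proj' x : proj m.+1 b' x = proj m b x + inner x n *: n.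
  rewrite /proj big_ord_recr/= {3 4}/b' ltnn; congr (_ + _).
  by apply: eq_bigr => i _; rewrite /b' ltn_ord.
have fix' x : proj m b x = x -> proj m.+1 b' x = x.
  move=> xE; rewrite proj' -{2}xE proj_sym proj_n inner0r scale0r addr0//.
have fix_r : inner r n *: n = r.
  have [->|r0] := eqVneq r 0; first by rewrite inner0l scale0r.
  rewrite /n innerZr inner_norm scalerA -[RHS]scale1r; congr (_ *: _).
  by field; rewrite normr_eq0.
exists m.+1, b'; split.
  move=> i; rewrite ltnS leq_eqVlt => /orP[/eqP ik|ik]; last exact/fix'/bE.
  have -> : e i = ek by congr e; apply/val_inj.
  have ekn : inner ek n = inner r n.
    by rewrite -[in LHS](subrK (proj m b ek) ek) innerDl proj_sym proj_n inner0r addr0.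
  by rewrite proj' ekn fix_r addrC subrK.
move=> i; rewrite ltnS leq_eqVlt /b' => /orP[/eqP ->|im]; last by rewrite im; exact/fix'/bb.
by rewrite ltnn -/b' proj' proj_n add0r {1}/n innerZl -scalerA fix_r.
Qed.

Lemma finite_dimensional_weak_cvg (z : nat -> H) (x : H) :
  finite_dimensional H -> weakly_converges z x -> z n @[n --> \oo] --> x.
Proof.
move=> /finite_dimensional_frame[m [b bE]] zx.
rewrite (_ : z = fun n => \sum_(i < m) inner (z n) (b i) *: b i); last first.
  by apply/funext => n; exact: bE.
rewrite [x in _ --> x]bE; apply: cvg_big => [|i _]; first exact: add_continuous.
apply: cvgZr_tmp; exact: zx.
Qed.

End finite_dimension.

(** * Quasi-Fejer sequences *)

Section quasi_fejer.
Context {R : realType}.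

(** Subtracting c times the partial sums of [e] from [s] gives a nonincreasing
    sequence that is bounded below. Hence [s] converges, and [rho] is squeezed
    between 0 and a difference that tends to 0. *)
Lemma quasi_fejer (s rho e : nat -> R) (c B : R) : 0 <= c ->
  (forall n, 0 <= s n) -> (forall n, 0 <= rho n) -> (forall n, 0 <= e n) ->
  (forall n, \sum_(0 <= i < n) e i <= B) ->
  (forall n, s n.+1 ^+ 2 + rho n <= (s n + c * e n) ^+ 2) ->
  exists2 l : R, s @ \oo --> l & rho @ \oo --> 0.
Proof.
move=> c0 s0 rho0 e0 eB step.
have s_le n : s n.+1 <= s n + c * e n.
  rewrite -(@ler_pXn2r _ 2)// ?nnegrE ?addr_ge0 ?mulr_ge0//.
  by apply: le_trans (step n); rewrite lerDl.
have e_cvg : cvgn (series e).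
  apply: nondecreasing_is_cvgn; last by exists B => _ [n _ <-]; exact: eB.
  by apply/nondecreasing_seqP => n; rewrite /series/= big_nat_recr//= lerDl.
have b_cvg : cvgn (fun n => s n - c * series e n).
  apply: nonincreasing_is_cvgn.
    apply/nonincreasing_seqP => n; rewrite /series/= big_nat_recr//=.
    have := s_le n; lra.
  exists (- (c * B)) => _ [n _ <-].
  have := ler_wpM2l c0 (eB n); have := s0 n; rewrite /series/=; lra.
have [l sl] : exists l : R, s @ \oo --> l.
  have /cvg_ex[l1 bl1] := b_cvg; have /cvg_ex[l2 el2] := e_cvg.
  exists (l1 + c * l2).
  rewrite (_ : s = (fun n => (s n - c * series e n) + c * series e n)); last first.
    by apply/funext => n; rewrite subrK.
  by apply: cvgD => //; apply: cvgM => //; exact: cvg_cst.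
exists l => //.
have e_cvg0 : e @ \oo --> 0 := cvg_series_cvg_0 e_cvg.
apply: (@squeeze_cvgr _ _ _ _ (fun=> 0) (fun n => (s n + c * e n) ^+ 2 - s n.+1 ^+ 2)).
- by apply: filterE => n; rewrite rho0/=; have := step n; lra.
- exact: cvg_cst.
- have sl1 : s n.+1 @[n --> \oo] --> l by rewrite cvg_shiftS.
  have -> : (0 : R) = (l + c * 0) ^+ 2 - l ^+ 2 by ring.
  rewrite !expr2; apply: cvgB; apply: cvgM => //.
    by apply: cvgD => //; apply: cvgM => //; exact: cvg_cst.
  by apply: cvgD => //; apply: cvgM => //; exact: cvg_cst.
Qed.

Lemma cvg0_of_norm_sq {H : hilbertType R} (t : nat -> H) (rho : nat -> R) (m : R) :
  0 < m -> (forall n, m * `|t n| ^+ 2 <= rho n) -> rho @ \oo --> 0 ->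
  t @ \oo --> 0.
Proof.
move=> m0 le rho0; apply/cvgr0Pnorm_lt => e e0.
have me : 0 < m * e ^+ 2 by rewrite mulr_gt0// exprn_gt0.
have /cvgr0Pnorm_lt/(_ _ me) := rho0; apply: filterS => n /=.
move=> /(le_lt_trans (ler_norm _))/(le_lt_trans (le n)).
by rewrite ltr_pM2l// ltr_pXn2r// ?nnegrE ?normr_ge0 ?(ltW e0).
Qed.

End quasi_fejer.

Section averages.
Context {R : realType} {H : hilbertType R}.

(** Jensen's inequality for the squared distance to [z]: bound each term below
    by its tangent at the mean [m]. *)
Lemma average_norm_sq (K : nat) (x : nat -> H) (m z : H) : (1 <= K)%N ->
  m = K%:R^-1 *: \sum_(1 <= k < K.+1) x k ->
  K%:R * `|m - z| ^+ 2 <= \sum_(1 <= k < K.+1) `|x k - z| ^+ 2.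
Proof.
move=> K1 mE; have Kn0 : (K%:R : R) != 0 by rewrite pnatr_eq0 -lt0n.
have sumE : \sum_(1 <= k < K.+1) x k = K%:R *: m.
  by rewrite mE scalerA divff// scale1r.
have low k : 2 * inner (x k) (m - z) - (2 * inner z (m - z) + `|m - z| ^+ 2)
    <= `|x k - z| ^+ 2.
  have := sqr_ge0 `|(x k - z) - (m - z)|.
  by rewrite (norm_sqB (x k - z)) (innerBl (x k)); lra.
apply: le_trans (ler_sum _ (fun k _ => low k)).
rewrite sumrB -mulr_sumr -inner_suml sumE innerZl sumr_const_nat subn1/= -mulr_natl.
rewrite -[`|m - z| ^+ 2]inner_norm (innerBl m z); lra.
Qed.

End averages.

(** * The primal-dual inclusion *)

Section primal_dual_inclusion.
Context {R : realType} {U V : hilbertType R}.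
Variables (C : R) (T : U -> U) (L : {linear U -> V}).
Variables (f : V -> \bar R) (g : U -> \bar R) (alpha sigma : R).
Hypotheses (C_gt0 : 0 < C) (T_cocoercive : cocoercive C T).
Hypothesis L_bounded : bounded_fun_norm L.
Hypotheses (f_pcl : proper_convex_lsc f) (g_pcl : proper_convex_lsc g).
Hypotheses (alpha_gt0 : 0 < alpha) (sigma_gt0 : 0 < sigma).

Let f_proper : Defs.proper f. Proof. by case: f_pcl. Qed.
Let g_proper : Defs.proper g. Proof. by case: g_pcl. Qed.

Lemma primal_dual_solutionE x y : primal_dual_solution T L f g x y <->
  subdifferential g x (- adjoint L y - T x) /\ subdifferential f (L x) y.
Proof.
split=> -[gx fy]; split=> //.
  by case: gx => p gp <-; rewrite addrC addKr.
by exists (- adjoint L y - T x) => //; rewrite addrC subrK.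
Qed.

(** The subgradient of [g] at [u] that a primal proximal step from [ub]
    produces. *)
Definition primal_residual (ub u : U) (v : V) : U :=
  alpha^-1 *: (ub - alpha *: (T ub + adjoint L v) - u).

(** The point at which, by Moreau's decomposition, [v1] is a subgradient of [f]
    after a dual proximal step from [v0]. *)
Definition dual_residual (u : U) (v0 v1 : V) : V :=
  sigma^-1 *: (v0 + sigma *: L u - v1).

Lemma primal_residualE ub u v : primal_residual ub u v =
  alpha^-1 *: (ub - u) - T ub - adjoint L v.
Proof.
rewrite /primal_residual; apply: inner_inj => z; rewrite !innerE; field.
by rewrite gt_eqF.
Qed.

Lemma dual_residualE u v0 v1 : dual_residual u v0 v1 =
  L u - sigma^-1 *: (v1 - v0).
Proof.
rewrite /dual_residual; apply: inner_inj => z; rewrite !innerE; field.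
by rewrite gt_eqF.
Qed.

Section limit_points.
Variables (I : Type) (G : set_system I) (GP : ProperFilter G).
Variables (ub ut : I -> U) (v0 v1 : I -> V) (M : R) (t : U) (x : U) (y : V).
Hypotheses (ub_bounded : forall i, `|ub i| <= M) (ut_bounded : forall i, `|ut i| <= M).
Hypothesis v1_bounded : forall i, `|v1 i| <= M.
Hypotheses (ub_ut : ub i - ut i @[i --> G] --> (0 : U))
  (v1_v0 : v1 i - v0 i @[i --> G] --> (0 : V))
  (T_cvg : T (ub i) - t @[i --> G] --> (0 : U)).
Hypotheses (ub_x : weak_cvg G ub x) (v0_y : weak_cvg G v0 y).
Hypothesis g_sub : forall i,
  subdifferential g (ut i) (primal_residual (ub i) (ut i) (v0 i)).
Hypothesis f_sub : forall i,
  subdifferential f (dual_residual (ut i) (v0 i) (v1 i)) (v1 i).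

Let ut_x : weak_cvg G ut x.
Proof.
have -> : ut = (fun i => ub i - (ub i - ut i)).
  by apply/funext => i; rewrite subKr.
exact: weak_cvgB0.
Qed.

Let inner_bounded_cvg0 {H : hilbertType R} (z s : I -> H) (w : H) :
  (forall i, `|z i| <= M) -> s @ G --> 0 ->
  inner (z i - w) (s i) @[i --> G] --> (0 : R).
Proof.
move=> zM s0; apply: (inner_cvg0 (M := M + `|w|)) => // i.
by apply: le_trans (ler_normB _ _) _; rewrite lerD2r.
Qed.

(** Cocoercivity makes [T] demiclosed. The square of T (ub i) - T x is replaced
    by a lower bound that is linear in [ub i] up to terms tending to 0, so that
    weak convergence suffices to pass to the limit. *)
Lemma cocoercive_limit : T x = t.
Proof.
pose d := t - T x.
pose s i := inner (ub i - x) (T (ub i) - t) + inner (ub i) d - inner x d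
  - 2 * C * inner d (T (ub i) - t) - C * inner d d.
have s_ge0 i : - s i <= 0.
  have := T_cocoercive (ub i) x.
  have := mulr_ge0 (ltW C_gt0) (sqr_ge0 `|T (ub i) - t|).
  have -> : T (ub i) - T x = (T (ub i) - t) + d by rewrite /d addrA subrK.
  rewrite (norm_sqD _ d) -(inner_norm d) /s (innerDl _ d) (innerC (ub i - x)).
  by rewrite (innerC d) (innerC d) (innerBl _ x d); lra.
have s_cvg : (fun i => - s i) @ G -->
    - (0 + inner x d - inner x d - 2 * C * 0 - C * inner d d).
  apply: cvgN; apply: cvgB; last exact: cvg_cst.
  apply: cvgB.
    apply: cvgB; last exact: cvg_cst.
    by apply: cvgD; [exact: inner_bounded_cvg0|exact: ub_x].
  apply: cvgM; first exact: cvg_cst.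
  exact: (inner_cvg0 (z := fun=> d) (M := `|d|)).
have := cvg_le_cst (FF := GP) s_cvg s_ge0; rewrite inner_norm => le0.
apply/esym/eqP; rewrite -subr_eq0; apply/eqP/norm_sq_le0.
by rewrite -(pmulr_rle0 _ C_gt0) -/d; lra.
Qed.

(* Add the monotonicity inequalities of the two subdifferentials: the products
   of weakly convergent terms L (ut i) and v0 i cancel up to v1 i - v0 i, which
   tends to 0 strongly. What is left is affine in the weak limits, apart from
   the terms collected in [null]. *)
Let limit_monotone a p b r : subdifferential g a p -> subdifferential f b r ->
  0 <= inner (a - x) (t + p) + inner y (L a) - inner (L x) r - inner y b
       + inner b r.
Proof.
move=> gap fbr.
pose null i := alpha^-1 * inner (ut i - a) (ub i - ut i)
  - inner (ut i - a) (T (ub i) - t) + inner (L (ut i)) (v1 i - v0 i)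
  - inner b (v1 i - v0 i) - sigma^-1 * inner (v1 i - r) (v1 i - v0 i).
pose s i := null i + inner a (t + p) + inner b r - inner (ut i) (t + p)
   + inner (v0 i) (L a) - inner (ut i) (adjoint L r) - inner (v0 i) b.
have s_ge0 i : - s i <= 0.
  have := subdifferential_monotone g_proper (g_sub i) gap.
  have := subdifferential_monotone f_proper (f_sub i) fbr.
  rewrite primal_residualE dual_residualE /s /null -adjointE// !innerE.
  rewrite ![inner (adjoint _ _) _]innerC -!adjointE//.
  rewrite !(innerC a (ub i), innerC a (ut i), innerC a (T (ub i)), innerC a t,
    innerC a p, innerC (ut i) (ub i), innerC (ut i) (T (ub i)),
    innerC (ut i) t, innerC (ut i) p, innerC b (L (ut i)), innerC b (v0 i),
    innerC b (v1 i), innerC b r, innerC (v0 i) (L (ut i)),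
    innerC (v1 i) (L (ut i)), innerC r (L (ut i)), innerC (v0 i) (v1 i),
    innerC r (v0 i), innerC r (v1 i), innerC (v0 i) (L a), innerC (v1 i) (L a)).
  lra.
have null_cvg : null @ G --> alpha^-1 * 0 - 0 + 0 - 0 - sigma^-1 * 0.
  apply: cvgB; last by apply: cvgM; [exact: cvg_cst|exact: inner_bounded_cvg0].
  apply: cvgB; last exact: (inner_cvg0 (z := fun=> b) (M := `|b|)).
  apply: cvgD; last first.
    apply: (inner_cvg0 (M := opnorm L * M)) => // i.
    by apply: le_trans (le_opnorm L_bounded _) _; rewrite ler_wpM2l// opnorm_ge0.
  apply: cvgB; last exact: inner_bounded_cvg0.
  by apply: cvgM; [exact: cvg_cst|exact: inner_bounded_cvg0].
have s_cvg : (fun i => - s i) @ G -->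
  - (alpha^-1 * 0 - 0 + 0 - 0 - sigma^-1 * 0 + inner a (t + p) + inner b r
   - inner x (t + p) + inner y (L a) - inner x (adjoint L r) - inner y b).
  apply: cvgN; apply: cvgB; last exact: v0_y.
  apply: cvgB; last exact: ut_x.
  apply: cvgD; last exact: v0_y.
  apply: cvgB; last exact: ut_x.
  by apply: cvgD; [apply: cvgD => //|]; exact: cvg_cst.
have := cvg_le_cst (FF := GP) s_cvg s_ge0; rewrite -adjointE// innerBl; lra.
Qed.

(** Minty's argument: test the limiting inequality at the resolvents of the two
    subdifferentials, where it says that a sum of two squared distances is at
    most 0. *)
Lemma limit_point_solution : primal_dual_solution T L f g x y.
Proof.
apply/primal_dual_solutionE; rewrite cocoercive_limit.
have gap := prox_subdifferential g_pcl (x + (- adjoint L y - t)) ltr01.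
have fbr := prox_subdifferential f_pcl (L x + y) ltr01.
set a := prox 1 g _ in gap; set b := prox 1 f _ in fbr.
rewrite invr1 scale1r in gap; rewrite invr1 scale1r in fbr.
have le := limit_monotone gap fbr.
have dist0 : `|x - a| ^+ 2 + `|L x - b| ^+ 2 <= 0.
  move: le; rewrite -!inner_norm !innerE -!adjointE//.
  rewrite !(innerC a x, innerC x t, innerC a t, innerC b (L x), innerC b y,
    innerC y (L x), innerC y (L a), innerC (adjoint L y)) -?adjointE//.
  lra.
have xa : x = a.
  apply/eqP; rewrite -subr_eq0; apply/eqP/norm_sq_le0.
  by have := sqr_ge0 `|L x - b|; lra.
have Lxb : L x = b.
  apply/eqP; rewrite -subr_eq0; apply/eqP/norm_sq_le0.
  by have := sqr_ge0 `|x - a|; lra.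
by rewrite -xa addrC addKr in gap; rewrite -Lxb addrC addKr in fbr.
Qed.

End limit_points.

Section energy_step.
Variables (ub u0 u1 uh : U) (v0 v1 vh : V).
Hypothesis sol : primal_dual_solution T L f g uh vh.
Hypothesis g_sub0 : subdifferential g u0 (primal_residual ub u0 v0).
Hypothesis g_sub1 : subdifferential g u1 (primal_residual ub u1 v1).
Hypothesis f_sub : subdifferential f (dual_residual u0 v0 v1) v1.

Let w := ub - uh - alpha *: (T ub - T uh).

(** The decrease obtained from one inner iteration. The dual update contributes
    monotonicity of the subdifferential of [f]. The primal updates contribute
    cyclic monotonicity of the subdifferential of [g] along [uh], [u0], [u1],
    which evaluates the coupling term at the old primal point and the new dual
    point, as the dual update requires. The remaining cross term between
    [u1 - u0] and [v1 - v0] is absorbed by Young's inequality, and this is where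
    the norm of [L] limits the step size. *)
Lemma energy_step :
  alpha / sigma * `|v1 - vh| ^+ 2 + `|u1 - uh| ^+ 2
    + (alpha * (sigma^-1 - alpha * opnorm L ^+ 2) * `|v1 - v0| ^+ 2
       + `|w - (u0 - uh)| ^+ 2)
  <= alpha / sigma * `|v0 - vh| ^+ 2 + `|w| ^+ 2.
Proof.
have [gh fh] := (primal_dual_solutionE uh vh).1 sol.
have cyc := subdifferential_cyclic g_proper gh g_sub0 g_sub1.
have scale u v z : alpha * inner (primal_residual ub u v) z =
    inner (ub - alpha *: (T ub + adjoint L v) - u) z.
  by rewrite /primal_residual innerZl mulVKf ?gt_eqF.
have {}cyc : inner (ub - alpha *: (T ub + adjoint L v0) - u0) (u1 - u0)
   + inner (ub - alpha *: (T ub + adjoint L v1) - u1) (uh - u1)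
   - alpha * inner (adjoint L vh + T uh) (u0 - uh) <= 0.
  rewrite -!scale; move: cyc; rewrite -opprD innerNl -(pmulr_rle0 _ alpha_gt0).
  by rewrite !mulrDr; lra.
have mono := subdifferential_monotone f_proper f_sub fh.
have {}mono : 0 <= alpha * inner (L (u0 - uh)) (v1 - vh)
    - alpha / sigma * inner (v1 - v0) (v1 - vh).
  have -> : alpha * inner (L (u0 - uh)) (v1 - vh)
      - alpha / sigma * inner (v1 - v0) (v1 - vh) =
      alpha * inner (dual_residual u0 v0 v1 - L uh) (v1 - vh).
    by rewrite dual_residualE linearB !innerE; ring.
  by rewrite innerC mulr_ge0 ?(ltW alpha_gt0).
have young : - (2 * alpha * inner (L (u1 - u0)) (v1 - v0)) - `|u1 - u0| ^+ 2
    <= alpha ^+ 2 * opnorm L ^+ 2 * `|v1 - v0| ^+ 2.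
  have le1 : - inner (L (u1 - u0)) (v1 - v0)
      <= opnorm L * `|u1 - u0| * `|v1 - v0|.
    apply: le_trans (ler_norm _) _; rewrite normrN.
    by apply: le_trans (cauchy_schwarz _ _) _; rewrite ler_wpM2r// le_opnorm.
  have := ler_wpM2l (ltW alpha_gt0) le1.
  have := sqr_ge0 (`|u1 - u0| - alpha * opnorm L * `|v1 - v0|).
  lra.
have -> : alpha * (sigma^-1 - alpha * opnorm L ^+ 2) * `|v1 - v0| ^+ 2 =
    alpha / sigma * `|v1 - v0| ^+ 2 - alpha ^+ 2 * opnorm L ^+ 2 * `|v1 - v0| ^+ 2.
  by ring.
have -> : alpha / sigma * `|v0 - vh| ^+ 2 = alpha / sigma * `|v1 - vh| ^+ 2
    - 2 * (alpha / sigma * inner (v1 - v0) (v1 - vh)) + alpha / sigma * `|v1 - v0| ^+ 2.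
  have -> : v0 - vh = (v1 - vh) - (v1 - v0).
    by apply: inner_inj => z; rewrite !innerE; ring.
  by rewrite (norm_sqB (v1 - vh)) (innerC (v1 - vh)); ring.
(* The key inequality is [cyc] after polarization. *)
suff key : 2 * (alpha * inner (L (u0 - uh)) (v1 - vh)) + `|u1 - uh| ^+ 2
   + `|w - (u0 - uh)| ^+ 2 <=
   - (2 * alpha * inner (L (u1 - u0)) (v1 - v0)) - `|u1 - u0| ^+ 2 + `|w| ^+ 2.
  by lra.
move: cyc; rewrite -!inner_norm /w !linearB !innerE.
rewrite !(innerC u0 u1, innerC uh u1, innerC uh u0, innerC u0 ub, innerC u1 ub,
  innerC uh ub, innerC (T ub) ub, innerC (T uh) ub, innerC u0 (T ub),
  innerC u1 (T ub), innerC uh (T ub), innerC (T uh) (T ub), innerC u0 (T uh),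
  innerC u1 (T uh), innerC uh (T uh), innerC (adjoint L v0),
  innerC (adjoint L v1), innerC (adjoint L vh)) -!adjointE//.
lra.
Qed.

(** Cocoercivity makes the forward step with [T] nonexpansive when
    alpha <= 2 C, with a gain that controls T ub - T uh. *)
Lemma forward_step : `|w| ^+ 2 <=
  `|ub - uh| ^+ 2 - alpha * (2 * C - alpha) * `|T ub - T uh| ^+ 2.
Proof.
rewrite /w norm_sqB normrZ exprMn (gtr0_norm alpha_gt0) innerZr (innerC (ub - uh)).
have := ler_wpM2l (ltW alpha_gt0) (T_cocoercive ub uh).
lra.
Qed.

End energy_step.

End primal_dual_inclusion.

(** * Convergence of the algorithm *)

Section algorithm.
Context {R : realType} {U V : hilbertType R}.
Variables (C : R) (T : U -> U) (L : {linear U -> V}).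
Variables (f : V -> \bar R) (g : U -> \bar R) (alpha beta : R) (kmax : nat).
Variables (gamma : nat -> R) (u ubar : nat -> U) (uk : nat -> nat -> U).
Variable v : nat -> nat -> V.
Hypotheses (C_gt0 : 0 < C) (T_cocoercive : cocoercive C T).
Hypothesis L_bounded : bounded_fun_norm L.
Hypotheses (f_pcl : proper_convex_lsc f) (g_pcl : proper_convex_lsc g).
Hypotheses (alpha_gt0 : 0 < alpha) (alpha_lt : alpha < 2 * C).
Hypotheses (beta_gt0 : 0 < beta) (beta_lt : beta * opnorm L ^+ 2 < 1).
Hypotheses (kmax_ge1 : (1 <= kmax)%N) (gamma_ge0 : forall n, 0 <= gamma n).
Hypothesis ubarE : forall n, ubar n = u n + gamma n *: (u n - u n.-1).
Hypothesis v0E : forall n, v n.+1 0%N = v n kmax.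
Hypothesis ukE : forall n k, (k <= kmax)%N ->
  uk n k = prox alpha g (ubar n - alpha *: (T (ubar n) + adjoint L (v n k))).
Hypothesis vE : forall n k, (k < kmax)%N ->
  v n k.+1 = prox (beta * alpha^-1) (fenchel_conjugate f)
    (v n k + (beta * alpha^-1) *: L (uk n k)).
Hypothesis uE : forall n,
  u n.+1 = (kmax%:R)^-1 *: \sum_(1 <= k < kmax.+1) uk n k.

Let sigma := beta * alpha^-1.
Let kappa := alpha / sigma.
Let K : R := kmax%:R.

Let sigma_gt0 : 0 < sigma. Proof. by rewrite mulr_gt0 ?invr_gt0. Qed.
Let kappa_gt0 : 0 < kappa. Proof. by rewrite divr_gt0. Qed.
Let K_gt0 : 0 < K. Proof. by rewrite ltr0n. Qed.

(* The bound on [beta] leaves a positive coefficient in front of the dual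
   increments of [energy_step]. *)
Let slack_gt0 : 0 < alpha * (sigma^-1 - alpha * opnorm L ^+ 2).
Proof.
have -> : sigma^-1 - alpha * opnorm L ^+ 2 =
    alpha / beta * (1 - beta * opnorm L ^+ 2).
  by rewrite /sigma; field; rewrite !gt_eqF.
by rewrite !mulr_gt0 ?invr_gt0// subr_gt0.
Qed.

Lemma uk_subdifferential n k : (k <= kmax)%N ->
  subdifferential g (uk n k) (primal_residual T L alpha (ubar n) (uk n k) (v n k)).
Proof. by move=> /(ukE n) ->; exact: prox_subdifferential. Qed.

Lemma v_subdifferential n k : (k < kmax)%N ->
  subdifferential f (dual_residual L sigma (uk n k) (v n k) (v n k.+1)) (v n k.+1).
Proof. by move=> /(vE n) ->; exact: prox_fenchel_conjugate. Qed.

Section one_solution.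
Variables (uh : U) (vh : V).
Hypothesis sol : primal_dual_solution T L f g uh vh.

Let w n := ubar n - uh - alpha *: (T (ubar n) - T uh).

(** The factor [K] balances the average that defines [u n.+1] against the
    [kmax] inner iterations, over which the dual terms telescope. *)
Definition energy n := K * `|u n - uh| ^+ 2 + kappa * `|v n 0%N - vh| ^+ 2.

(** Only the first inner iteration is retained: the pair [uk n 0], [v n 1]
    already determines the limit points. *)
Definition energy_gap n :=
  alpha * (sigma^-1 - alpha * opnorm L ^+ 2) * `|v n 1%N - v n 0%N| ^+ 2
  + `|w n - (uk n 0%N - uh)| ^+ 2
  + alpha * (2 * C - alpha) * `|T (ubar n) - T uh| ^+ 2.

(* Sum of [energy_step] over the first [j] inner iterations. *)
Let inner_energy n j : (j <= kmax)%N ->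
  kappa * `|v n j - vh| ^+ 2 + \sum_(0 <= k < j) `|uk n k.+1 - uh| ^+ 2
    + \sum_(0 <= k < j)
       (alpha * (sigma^-1 - alpha * opnorm L ^+ 2) * `|v n k.+1 - v n k| ^+ 2
        + `|w n - (uk n k - uh)| ^+ 2)
  <= kappa * `|v n 0%N - vh| ^+ 2 + j%:R * `|w n| ^+ 2.
Proof.
elim: j => [|j IH] jK; first by rewrite !big_geq// mul0r !addr0.
rewrite !big_nat_recr//= -natr1 mulrDl mul1r.
have := IH (ltnW jK).
have := energy_step L_bounded f_pcl g_pcl alpha_gt0 sigma_gt0 sol
  (uk_subdifferential n (ltnW jK)) (uk_subdifferential n jK)
  (v_subdifferential n jK).
rewrite -/kappa -/(w n); lra.
Qed.

Let energy_decrease n :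
  energy n.+1 + energy_gap n <=
    K * `|ubar n - uh| ^+ 2 + kappa * `|v n 0%N - vh| ^+ 2.
Proof.
have := inner_energy n (leqnn kmax).
have := average_norm_sq uh kmax_ge1 (uE n).
rewrite big_add1/= -/K => avg.
rewrite [X in _ + X <= _](@big_ltn _ _ _ 0%N)//.
set rest := \sum_(1 <= k < kmax) _.
have rest_ge0 : 0 <= rest.
  apply: sumr_ge0 => k _; rewrite addr_ge0 ?sqr_ge0// mulr_ge0 ?sqr_ge0//.
  exact: ltW.
have fwd := forward_step T_cocoercive alpha_gt0 (ubar n) uh.
have K1 : 1 <= K by rewrite ler1n.
have : K * `|w n| ^+ 2 <= K * `|ubar n - uh| ^+ 2
    - alpha * (2 * C - alpha) * `|T (ubar n) - T uh| ^+ 2.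
  have T_ge0 : 0 <= alpha * (2 * C - alpha) * `|T (ubar n) - T uh| ^+ 2.
    by rewrite mulr_ge0 ?sqr_ge0// mulr_ge0 ?(ltW alpha_gt0)// subr_ge0 ltW.
  have := ler_wpM2l (ltW K_gt0) fwd.
  have : 0 <= (K - 1) * (alpha * (2 * C - alpha) * `|T (ubar n) - T uh| ^+ 2).
    by rewrite mulr_ge0// subr_ge0.
  rewrite -/(w n); lra.
rewrite /energy /energy_gap v0E; lra.
Qed.

Let energy_gap_ge0 n : 0 <= energy_gap n.
Proof.
rewrite /energy_gap !addr_ge0 ?sqr_ge0// mulr_ge0 ?sqr_ge0//; first exact: ltW.
by rewrite mulr_ge0 ?(ltW alpha_gt0)// subr_ge0 ltW.
Qed.

(** The square root of the energy is a weighted norm in the product space, so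
    the inertial shift increases it by at most a multiple of the summable
    gamma n |u n - u n.-1|; [quasi_fejer] applies to it. *)
Lemma energy_cvg (B : R) :
  (forall n, \sum_(0 <= i < n) gamma i * `|u i - u i.-1| <= B) ->
  (exists l : R, energy @ \oo --> l) /\ energy_gap @ \oo --> 0.
Proof.
move=> eB.
have energy_ge0 n : 0 <= energy n.
  by rewrite addr_ge0// mulr_ge0 ?sqr_ge0 ?(ltW K_gt0) ?(ltW kappa_gt0).
have sqrE n : Num.sqrt (energy n) ^+ 2 = energy n by rewrite sqr_sqrtr.
have [l sl gap0] : exists2 l : R,
    Num.sqrt (energy n) @[n --> \oo] --> l & energy_gap @ \oo --> 0.
  apply: (quasi_fejer (c := Num.sqrt K) _ _ _ _ eB) => // [n|n].
    by rewrite mulr_ge0.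
  rewrite sqrE; apply: le_trans (energy_decrease n) _.
  set e := gamma n * _.
  have e_ge0 : 0 <= e by rewrite mulr_ge0.
  have ub_le : `|ubar n - uh| <= `|u n - uh| + e.
    rewrite ubarE addrAC; apply: le_trans (ler_normD _ _) _.
    by rewrite lerD2l normrZ (ger0_norm (gamma_ge0 n)).
  have u_le : Num.sqrt K * `|u n - uh| <= Num.sqrt (energy n).
    rewrite -normr_id -sqrtr_sqr -sqrtrM ?(ltW K_gt0)// ler_sqrt//.
    by rewrite /energy lerDl mulr_ge0 ?sqr_ge0 ?(ltW kappa_gt0).
  have ub_sq : `|ubar n - uh| ^+ 2 <= (`|u n - uh| + e) ^+ 2.
    by rewrite ler_pXn2r// nnegrE ?addr_ge0.
  have KE : K = Num.sqrt K ^+ 2 by rewrite sqr_sqrtr// ltW.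
  have := ler_wpM2l (ltW K_gt0) ub_sq.
  have := ler_wpM2l (mulr_ge0 (sqrtr_ge0 K) e_ge0) u_le.
  rewrite [in X in _ -> _ -> X]sqrrD sqrE /energy exprMn -[Num.sqrt K ^+ 2]KE.
  have -> : Num.sqrt K * e * (Num.sqrt K * `|u n - uh|) = K * e * `|u n - uh|.
    by rewrite [in RHS]KE; ring.
  lra.
split=> //; exists (l * l).
rewrite (_ : energy = fun n => Num.sqrt (energy n) * Num.sqrt (energy n)); last first.
  by apply/funext => n; rewrite -expr2 sqrE.
exact: cvgM.
Qed.

End one_solution.

Variable B : R.
Hypothesis inertia_summable :
  forall n, \sum_(0 <= i < n) gamma i * `|u i - u i.-1| <= B.

Let inertia_cvg0 : (u n - ubar n) @[n --> \oo] --> (0 : U).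
Proof.
have e_ge0 n : 0 <= gamma n * `|u n - u n.-1| by rewrite mulr_ge0.
have e_cvg : cvgn (series (fun n => gamma n * `|u n - u n.-1|)).
  apply: nondecreasing_is_cvgn; last first.
    by exists B => _ [n _ <-]; exact: inertia_summable.
  by apply/nondecreasing_seqP => n; rewrite /series/= big_nat_recr//= lerDl.
have e_cvg0 := cvg_series_cvg_0 e_cvg.
apply/cvgr0Pnorm_lt => e e0; have /cvgr0Pnorm_lt/(_ _ e0) := e_cvg0.
apply: filterS => n /=; rewrite normrM normr_id ubarE opprD addrA subrr sub0r.
by rewrite normrN normrZ.
Qed.

Let cvg0_bounded {H : hilbertType R} (t : nat -> H) :
  t @ \oo --> 0 -> exists M, forall n, `|t n| <= M.
Proof.
move=> t0; have [M [_ Mt]] := cvg_seq_bounded (cvgP _ t0).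
by exists (M + 1) => n; apply: Mt => //; rewrite ltrDl.
Qed.

Section solution.
Variables (uh : U) (vh : V).
Hypothesis sol : primal_dual_solution T L f g uh vh.

Lemma iterates_bounded : exists M,
  (forall n, `|u n| <= M) /\ (forall n, `|v n 0%N| <= M).
Proof.
have [[l El] _] := energy_cvg sol inertia_summable.
have [M [_ ME]] := cvg_seq_bounded (cvgP _ El).
have {}ME n : energy uh vh n <= M + 1.
  by apply: le_trans (ler_norm _) _; apply: ME => //; rewrite ltrDl.
have sq_le (a x : R) : 0 < a -> a * x ^+ 2 <= M + 1 -> x <= 1 + (M + 1) / a.
  move=> a0; rewrite mulrC -ler_pdivlMr// => le.
  (* x <= 1 + x ^+ 2 for every real x. *)
  have := sqr_ge0 (x - 2^-1); lra.
exists (`|uh| + (1 + (M + 1) / K) + (`|vh| + (1 + (M + 1) / kappa))).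
have K_le n : `|u n - uh| <= 1 + (M + 1) / K.
  apply: (sq_le _ _ K_gt0); apply: le_trans (ME n).
  by rewrite lerDl mulr_ge0 ?sqr_ge0 ?(ltW kappa_gt0).
have kappa_le n : `|v n 0%N - vh| <= 1 + (M + 1) / kappa.
  apply: (sq_le _ _ kappa_gt0); apply: le_trans (ME n).
  by rewrite lerDr mulr_ge0 ?sqr_ge0 ?(ltW K_gt0).
have u_ge0 := le_trans (normr_ge0 _) (K_le 0%N).
have v_ge0 := le_trans (normr_ge0 _) (kappa_le 0%N).
have uh_ge0 := normr_ge0 uh; have vh_ge0 := normr_ge0 vh.
split=> n.
  rewrite -(subrK uh (u n)); apply: le_trans (ler_normD _ _) _.
  have := K_le n; lra.
rewrite -(subrK vh (v n 0%N)); apply: le_trans (ler_normD _ _) _.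
have := kappa_le n; lra.
Qed.

Lemma residuals_cvg0 :
  [/\ (ubar n - uk n 0%N) @[n --> \oo] --> (0 : U),
      (v n 1%N - v n 0%N) @[n --> \oo] --> (0 : V)
    & (T (ubar n) - T uh) @[n --> \oo] --> (0 : U)].
Proof.
have [_ gap0] := energy_cvg sol inertia_summable.
have T_gt0 : 0 < alpha * (2 * C - alpha) by rewrite mulr_gt0// subr_gt0.
have v_ge0 n : 0 <= alpha * (sigma^-1 - alpha * opnorm L ^+ 2)
    * `|v n 1%N - v n 0%N| ^+ 2.
  by rewrite mulr_ge0 ?sqr_ge0 ?(ltW slack_gt0).
have T_ge0 n : 0 <= alpha * (2 * C - alpha) * `|T (ubar n) - T uh| ^+ 2.
  by rewrite mulr_ge0 ?sqr_ge0 ?(ltW T_gt0).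
have w_ge0 n := sqr_ge0 `|ubar n - uh - alpha *: (T (ubar n) - T uh) - (uk n 0%N - uh)|.
have T0 : (T (ubar n) - T uh) @[n --> \oo] --> (0 : U).
  apply: (cvg0_of_norm_sq T_gt0 _ gap0) => n; rewrite /energy_gap.
  by have := v_ge0 n; have := w_ge0 n; lra.
have w0 : (ubar n - uh - alpha *: (T (ubar n) - T uh) - (uk n 0%N - uh))
    @[n --> \oo] --> (0 : U).
  apply: (cvg0_of_norm_sq ltr01 _ gap0) => n; rewrite /energy_gap mul1r.
  by have := v_ge0 n; have := T_ge0 n; lra.
split=> //; last first.
  apply: (cvg0_of_norm_sq slack_gt0 _ gap0) => n; rewrite /energy_gap.
  by have := T_ge0 n; have := w_ge0 n; lra.
rewrite (_ : (fun n => ubar n - uk n 0%N) = (fun n =>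
  (ubar n - uh - alpha *: (T (ubar n) - T uh) - (uk n 0%N - uh))
  + alpha *: (T (ubar n) - T uh))); last first.
  by apply/funext => n; apply: inner_inj => z; rewrite !innerE; ring.
have -> : (0 : U) = 0 + alpha *: 0 by rewrite scaler0 addr0.
by apply: cvgD => //; apply: cvgZ => //; exact: cvg_cst.
Qed.

(** By [residuals_cvg0] the points [ubar n], [uk n 0], [v n 1] share the weak
    limits of [u n], [v n 0], and the proximal steps give the inclusions at
    these points. *)
Lemma weak_limit_point_solution G x y : UltraFilter G -> \oo `<=` G ->
  weak_cvg G u x -> weak_cvg G (fun n => v n 0%N) y ->
  primal_dual_solution T L f g x y.
Proof.
move=> GU leG ux vy; have GP : ProperFilter G by exact: ultra_proper.
have [d0 dv0 T0] := residuals_cvg0.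
have [M [uM vM]] := iterates_bounded.
have [M1 eM] := cvg0_bounded inertia_cvg0.
have [M2 dM] := cvg0_bounded d0; have [M3 dvM] := cvg0_bounded dv0.
have ubM n : `|ubar n| <= M + M1.
  rewrite -(subKr (u n) (ubar n)); apply: le_trans (ler_normB _ _) _.
  exact: lerD.
have ukM n : `|uk n 0%N| <= M + M1 + M2.
  rewrite -(subKr (ubar n) (uk n 0%N)); apply: le_trans (ler_normB _ _) _.
  exact: lerD.
have v1M n : `|v n 1%N| <= M + M3.
  rewrite -(subrK (v n 0%N) (v n 1%N)); apply: le_trans (ler_normD _ _) _.
  by rewrite addrC; exact: lerD.
have M_ge0 := le_trans (normr_ge0 _) (uM 0%N).
have M1_ge0 := le_trans (normr_ge0 _) (eM 0%N).
have M2_ge0 := le_trans (normr_ge0 _) (dM 0%N).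
have M3_ge0 := le_trans (normr_ge0 _) (dvM 0%N).
have ubx : weak_cvg G ubar x.
  have -> : ubar = (fun n => u n - (u n - ubar n)).
    by apply/funext => n; rewrite subKr.
  by apply: weak_cvgB0 => // A /inertia_cvg0; exact: leG.
apply: (@limit_point_solution _ _ _ C T L f g alpha sigma _ _ _ _ _ _ _ _ G GP
  ubar (fun n => uk n 0%N) (fun n => v n 0%N) (fun n => v n 1%N)
  (M + M1 + M2 + M3) (T uh)) => //.
- by move=> n; have := ubM n; lra.
- by move=> n; have := ukM n; lra.
- by move=> n; have := v1M n; lra.
- by move=> A /d0; exact: leG.
- by move=> A /dv0; exact: leG.
- by move=> A /T0; exact: leG.
- by move=> n; apply: uk_subdifferential.
- by move=> n; apply: v_subdifferential.
Qed.

End solution.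

Lemma iterates_weakly_converge :
  (exists uh vh, primal_dual_solution T L f g uh vh) ->
  exists uh vh, [/\ primal_dual_solution T L f g uh vh,
    weakly_converges u uh & weakly_converges (fun n => v n 0%N) vh].
Proof.
move=> [uh [vh sol]]; have [M [uM vM]] := iterates_bounded sol.
apply: (opial K_gt0 kappa_gt0 uM vM) => [x y xy|G x y GU leG].
  by have [[l El] _] := energy_cvg xy inertia_summable; exists l.
exact: weak_limit_point_solution sol _ _ _ GU leG.
Qed.

End algorithm.

(* [u n], [ubar n], [uk n k], [v n k] are u_n, \bar u_n, u_n^k, v_n^k.
   Since [0.-1 = 0], the term [u n.-1] encodes the convention u_{-1} = u_0;
   the arbitrary v_{-1}^{kmax} is [v 0 0].
   In the bound on [beta], the inverse is that of [\bar R]: 0^-1 = +oo. *)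
Theorem theorem6 (R : realType) (U V : hilbertType R)
    (C : R) (T : U -> U) (L : {linear U -> V})
    (f : V -> \bar R) (g : U -> \bar R)
    (alpha beta : R) (kmax : nat) (gamma : nat -> R)
    (u ubar : nat -> U) (uk : nat -> nat -> U) (v : nat -> nat -> V)
    (C_gt0 : 0 < C) (T_cocoercive : cocoercive C T)
    (L_bounded : bounded_fun_norm L)
    (f_pcl : proper_convex_lsc f) (g_pcl : proper_convex_lsc g)
    (alpha_gt0 : 0 < alpha) (alpha_lt : alpha < 2 * C)
    (beta_gt0 : 0 < beta) (beta_lt : (beta%:E < (opnorm L ^+ 2)%:E^-1)%E)
    (kmax_ge1 : (1 <= kmax)%N) (gamma_ge0 : forall n, 0 <= gamma n)
    (ubarE : forall n, ubar n = u n + gamma n *: (u n - u n.-1))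
    (v0E : forall n, v n.+1 0%N = v n kmax)
    (ukE : forall n k, (k <= kmax)%N ->
       uk n k =
       prox alpha g (ubar n - alpha *: (T (ubar n) + adjoint L (v n k))))
    (vE : forall n k, (k < kmax)%N ->
       v n k.+1 =
       prox (beta * alpha^-1) (fenchel_conjugate f)
         (v n k + (beta * alpha^-1) *: L (uk n k)))
    (uE : forall n,
       u n.+1 = (kmax%:R)^-1 *: \sum_(1 <= k < kmax.+1) uk n k)
    (gamma_summable :
       (\sum_(0 <= n <oo) (gamma n * `|u n - u n.-1|)%:E < +oo)%E)
    (solvable : exists uhat vhat, primal_dual_solution T L f g uhat vhat) :
  bounded_set (range (fun n => (u n, v n 0%N))) /\
  exists uhat vhat,
    [/\ primal_dual_solution T L f g uhat vhat,
        weakly_converges u uhat,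
        weakly_converges (fun n => v n 0%N) vhat
      & finite_dimensional U -> finite_dimensional V ->
        (u n, v n 0%N) @[n --> \oo] --> (uhat, vhat)].
Proof.
have beta_opnorm : beta * opnorm L ^+ 2 < 1.
  have [->|L0] := eqVneq (opnorm L ^+ 2) 0; first by rewrite mulr0.
  have Lp : 0 < opnorm L ^+ 2 by rewrite lt_neqAle eq_sym L0 sqr_ge0.
  move: beta_lt; rewrite inver (negPf L0) lte_fin => lt.
  by rewrite -ltr_pdivlMr// div1r.
have [B eB] : exists B : R, forall n,
    \sum_(0 <= i < n) gamma i * `|u i - u i.-1| <= B.
  have e_ge0 i : (0 <= (gamma i * `|u i - u i.-1|)%:E)%E.
    by rewrite lee_fin mulr_ge0.
  exists (fine (\sum_(0 <= n <oo) (gamma n * `|u n - u n.-1|)%:E)%E) => n.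
  rewrite -lee_fin fineK ?ge0_fin_numE ?nneseries_ge0//.
  by rewrite -sumEFin; apply: nneseries_lim_ge.
have [uh0 [vh0 sol0]] := solvable.
split.
  have [M [uM vM]] := iterates_bounded T_cocoercive L_bounded f_pcl g_pcl
    alpha_gt0 alpha_lt beta_gt0 beta_opnorm kmax_ge1 gamma_ge0 ubarE v0E ukE vE
    uE eB sol0.
  exists M; split; first exact: num_real.
  move=> N MN _ [n _ <-]; rewrite /= prod_normE/= ge_max.
  by rewrite !(le_trans _ (ltW MN)).
have [uh [vh [sol u_uh v_vh]]] := iterates_weakly_converge C_gt0
  T_cocoercive L_bounded f_pcl g_pcl alpha_gt0 alpha_lt beta_gt0 beta_opnorm
  kmax_ge1 gamma_ge0 ubarE v0E ukE vE uE eB solvable.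
exists uh, vh; split=> // finU finV.
by apply: cvg_pair; apply: finite_dimensional_weak_cvg.
Qed.
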